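(* There is no bipartite circle graph $G$ whose independence complex $I(G)$ is homotopy equivalent to a wedge $\bigvee_{k} S^1$ of $k$ circles with $k \geq 3$.
   Context: A chord diagram is a circle with finitely many chords with pairwise distinct endpoints on the circle; its intersection graph has one vertex per chord, with adjacency iff chords intersect. A circle graph is the intersection graph of some chord diagram. For a simple graph $G$, the independence complex $I(G)$ is the simplicial complex on the vertices of $G$ whose simplices are the nonempty sets of pairwise non-adjacent vertices. $\bigvee_k S^1$ denotes the one-point union of $k$ copies of the circle. *)

(* Defs.v *)
From HB Require Import structures.
From mathcomp Require Import all_boot all_order all_algebra.
From mathcomp Require Import all_classical all_reals all_analysis.
Set Implicit Arguments. Unset Strict Implicit. Unset Printing Implicit Defensive.
Import Order.TTheory GRing.Theory Num.Theory.
Import numFieldNormedType.Exports.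
Local Open Scope classical_set_scope.
Local Open Scope ring_scope.

(* A finite simple graph on the vertex set 'I_n is a symmetric irreflexive
   relation e : rel 'I_n. *)

(* Chord diagram with n chords: chord i has endpoints at positions p i < q i
   (positions on the circle, read in cyclic order starting from a base point
   that is not an endpoint); all 2n endpoints pairwise distinct. Two chords
   intersect iff their endpoints interleave. *)
Definition chord_diagram (n : nat) (p q : 'I_n -> nat) : Prop :=
  (forall i, (p i < q i)%N) /\
  (forall i j, i != j -> [/\ p i != p j, q i != q j & p i != q j]).

Definition chords_cross (n : nat) (p q : 'I_n -> nat) (i j : 'I_n) : bool :=
  ((p i < p j < q i) && ~~ (p i < q j < q i))%N ||
  (~~ (p i < p j < q i) && (p i < q j < q i))%N.

Definition is_circle_graph (n : nat) (e : rel 'I_n) : Prop :=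
  exists p q : 'I_n -> nat, chord_diagram p q /\
    forall i j, i != j -> e i j = chords_cross p q i j.

Definition is_bipartite (n : nat) (e : rel 'I_n) : Prop :=
  exists c : 'I_n -> bool, forall i j, e i j -> c i != c j.

Definition indep_simplex (n : nat) (e : rel 'I_n) (S : {set 'I_n}) : Prop :=
  S != finset.set0 /\ forall i j, i \in S -> j \in S -> ~~ e i j.

(* geometric realization of the independence complex I(G) in R^n:
   convex combinations of vertices e_i spanning a simplex *)
Definition indep_realization (R : realType) (n : nat) (e : rel 'I_n)
  : set 'rV[R]_n :=
  [set x : 'rV[R]_n | (forall i, 0 <= x ord0 i) /\ \sum_i x ord0 i = 1 /\
           indep_simplex e (@finset.finset _ (fun i => x ord0 i != 0))].

(* the wedge of k circles, embedded in R^2 as the union of the circles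
   centred at (j,0) of radius j, j = 1..k (pairwise meeting only at 0) *)
Definition wedge_circles (R : realType) (k : nat) : set 'rV[R]_2 :=
  [set x : 'rV[R]_2 | exists j : nat, (1 <= j <= k)%N /\
     (x ord0 ord0 - j%:R) ^+ 2 + (x ord0 (lift ord0 ord0)) ^+ 2 = j%:R ^+ 2].

Definition unit_interval (R : realType) : set R := [set t | 0 <= t <= 1].
Arguments unit_interval R : clear implicits.

Definition homotopic_on (R : realType) (U : topologicalType) (A : set U)
  (f g : U -> U) : Prop :=
  exists H : R * U -> U,
    [/\ {within unit_interval R `*` A, continuous H},
        (forall t x, unit_interval R t -> A x -> A (H (t, x))),
        (forall x, A x -> H (0, x) = f x) &
        (forall x, A x -> H (1, x) = g x)].

Definition homotopy_equivalent (R : realType) (U V : topologicalType)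
  (A : set U) (B : set V) : Prop :=
  exists (f : U -> V) (g : V -> U),
    [/\ {within A, continuous f}, f @` A `<=` B,
        {within B, continuous g} & g @` B `<=` A] /\
    homotopic_on R A (g \o f) id /\
    homotopic_on R B (f \o g) id.

Arguments indep_realization R {n} e.
Arguments wedge_circles R k : clear implicits.
Arguments homotopic_on R {U} A f g.
Arguments homotopy_equivalent R {U V} A B.

(* Main.v *)
Require Import Defs.
From HB Require Import structures.
From mathcomp Require Import all_boot all_order all_algebra.
From mathcomp Require Import all_classical all_reals all_analysis.
From mathcomp Require Import zify ring lra.
Import numFieldNormedType.Exports.
Set Implicit Arguments. Unset Strict Implicit. Unset Printing Implicit Defensive.
Import Order.TTheory GRing.Theory Num.Theory Num.Def.

(** Let [c] be the 2-colouring. [I(G)] is covered by the set where the first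
    colour carries weight at least 1/3 and the set where the second one does;
    both are contractible, and the components of their overlap are the
    components of the graph of nonadjacent pairs of distinct colours. If
    there are at most three of these components, then among any three classes
    of H^1(I(G); Z/2) some nonempty subset has sum zero. Circles 1, 2, 3 of the
    wedge carry three independent classes, which a homotopy equivalence would
    pull back to independent ones. Hence there are four components, and a pair
    from each of them gives chords [a_i], [b_j] that cross exactly when
    [i <> j] (the graph of the 3-cube). This is impossible: as [b_i] crosses all
    the [a_j] but [a_i], no [a_i] separates two other [a_j]; but of three
    disjoint chords crossed by a common chord, the middle one separates the
    other two.

    H^1 with coefficients in Z/2 is handled by Alexander-Spanier cochains: a
    1-cochain is a function of pairs of points, of which only the values at
    close points matter, and closeness is uniform because all the spaces are
    compact. *)

(** * Chord diagrams *)

Section ChordDiagrams.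
Local Open Scope nat_scope.

Lemma chord_diagramP n (p q : 'I_n -> nat) i j :
  chord_diagram p q -> i != j ->
  p i < q i /\ p j < q j /\ p i <> p j /\ q i <> q j /\ p i <> q j /\ p j <> q i.
Proof.
move=> [lt dif] nij; have [/eqP ? /eqP ? /eqP ?] := dif _ _ nij.
have nji : j != i by rewrite eq_sym.
by have [_ _ /eqP ?] := dif _ _ nji; do !split.
Qed.

Lemma chords_crossE n (p q : 'I_n -> nat) i j :
  chord_diagram p q -> i != j -> chords_cross p q i j ->
  (p i < p j /\ p j < q i /\ q i < q j) \/ (p j < p i /\ p i < q j /\ q j < q i).
Proof. by move=> dg /(chord_diagramP dg); rewrite /chords_cross; clear dg; lia. Qed.

Lemma chords_disjointE n (p q : 'I_n -> nat) i j :
  chord_diagram p q -> i != j -> ~~ chords_cross p q i j ->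
  (q i < p j \/ q j < p i) \/ (p i < p j /\ q j < q i) \/ (p j < p i /\ q i < q j).
Proof. by move=> dg /(chord_diagramP dg); rewrite /chords_cross; clear dg; lia. Qed.

(* [p a < p x < q a] tells on which side of the chord [a] the chord [x] lies. *)
Lemma same_side n (p q : 'I_n -> nat) a b x y :
  chord_diagram p q -> a != b -> a != x -> a != y -> b != x -> b != y ->
  ~~ chords_cross p q a b -> ~~ chords_cross p q a x -> ~~ chords_cross p q a y ->
  chords_cross p q b x -> chords_cross p q b y ->
  (p a < p x < q a) = (p a < p y < q a).
Proof.
move=> dg nab nax nay nbx nby.
move=> /(chords_disjointE dg nab) ab /(chords_disjointE dg nax) ax.
move=> /(chords_disjointE dg nay) ay.
move=> /(chords_crossE dg nbx) bx /(chords_crossE dg nby) bY.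
have lt := (chord_diagramP dg nab, chord_diagramP dg nax, chord_diagramP dg nay).
case: lt => [[[? [? _]] [_ [? _]]] [_ [? _]]].
clear dg nab nax nay nbx nby.
(* The chord [b] avoids [a], so it lies on one side of [a]; [x] and [y] avoid [a] and cross [b], so
   they lie on that side too. *)
case: bx => bx; case: bY => bY; case: ab => [[]|[]] ab; try lia;
 case: ax => [[]|[]] ax; try lia; case: ay => [[]|[]] ay; lia.
Qed.

(** The chord [b] meets the disjoint chords [x], [y], [z] in a linear order, and the middle one has
    the other two on opposite sides. The two equations exclude [x] and [y] as the middle one. *)
Lemma transversal_separates n (p q : 'I_n -> nat) b x y z :
  chord_diagram p q -> x != y -> x != z -> y != z ->
  b != x -> b != y -> b != z ->
  ~~ chords_cross p q x y -> ~~ chords_cross p q x z -> ~~ chords_cross p q y z ->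
  chords_cross p q b x -> chords_cross p q b y -> chords_cross p q b z ->
  (p x < p y < q x) = (p x < p z < q x) ->
  (p y < p x < q y) = (p y < p z < q y) ->
  (p z < p x < q z) <> (p z < p y < q z).
Proof.
move=> dg nxy nxz nyz nbx nby nbz.
move=> /(chords_disjointE dg nxy) xy /(chords_disjointE dg nxz) xz /(chords_disjointE dg nyz) yz.
move=> /(chords_crossE dg nbx) bx /(chords_crossE dg nby) bY /(chords_crossE dg nbz) bz.
clear dg nxy nxz nyz nbx nby nbz.
case: bx => bx; case: bY => bY; case: xy => xy; try lia;
 case: bz => bz; case: xz => xz; try lia; case: yz => yz; lia.
Qed.

(* Only three of the [x i] and the four [y j] are needed: they form the graph
   BW_3 of Bouchet, a forbidden vertex-minor of circle graphs. *)
Lemma no_cube_minus_vertex n (p q : 'I_n -> nat) (x y : 'I_4 -> 'I_n) :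
  chord_diagram p q ->
  (forall i j, i != j -> x i != x j) ->
  (forall i j, x i != y j) ->
  (forall i j, i != j -> ~~ chords_cross p q (x i) (x j)) ->
  (forall i j, chords_cross p q (y j) (x i) = (i != j)) ->
  (forall i, ~~ chords_cross p q (x i) (y i)) -> False.
Proof.
move=> dg xx xy xnx yx xny.
have yx' i j : y j != x i by rewrite eq_sym xy.
have side i j k : i != j -> i != k ->
   (p (x i) < p (x j) < q (x i)) = (p (x i) < p (x k) < q (x i)).
  (* [y i] avoids [x i] and crosses both [x j] and [x k]. *)
  move=> ij ik; apply: (@same_side _ p q (x i) (y i)) => //; rewrite ?xx ?xnx ?yx //.
  + by rewrite eq_sym.
  + by rewrite eq_sym.
pose o k := @inord 3 k.
have o_inj k l : k < 4 -> l < 4 -> k != l -> o k != o l.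
  by move=> kl ll; apply: contra => /eqP /(congr1 (@nat_of_ord _)); rewrite !inordK // => ->.
(* [y 3] crosses [x 0], [x 1] and [x 2], none of which separates the other two. *)
apply: (@transversal_separates _ p q (y (o 3)) (x (o 0)) (x (o 1)) (x (o 2))) => //;
  rewrite ?xx ?xnx ?yx ?o_inj //; apply: side; exact: o_inj.
Qed.

End ChordDiagrams.

Local Open Scope classical_set_scope.
Local Open Scope ring_scope.

(** * Alexander-Spanier 1-cochains mod 2 *)

Section AlexanderSpanier.
Variables (R : realType).
Implicit Types U V W : normedModType R.

Definition unif_on U V (A : set U) (f : U -> V) := forall e : R, 0 < e ->
  exists2 d : R, 0 < d & forall x y, A x -> A y -> `|x - y| < d -> `|f x - f y| < e.

(** Heine-Cantor: half the radius of continuity at a point serves all nearby points, and the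
    near-covering form of compactness yields one threshold for the whole of [A]. *)
Lemma compact_unif_on U V (A : set U) (f : U -> V) :
  compact A -> {within A, continuous f} -> unif_on A f.
Proof.
move=> /compact_near_coveringP/near_covering_withinP cA cf e e0.
have e20 : 0 < e / 2 by rewrite divr_gt0.
have := cA R (0^'+) (fun d x => forall y, A y -> `|x - y| < d -> `|f x - f y| < e).
move=> /(_ _ _)[].
  move=> x Ax.
  have /subspace_continuousP/(_ x Ax)/cvgrPdist_lt/(_ _ e20) := cf.
  move=> /nbhs_ballP[r /= r0 rP].
  have r20 : 0 < r / 2 by rewrite divr_gt0.
  exists (ball x (r / 2), [set d : R | 0 < d < r / 2]).
    split; first exact: nbhsx_ballx.
    exists (r / 2) => //= d /=; rewrite sub0r normrN => dr d0.
    by rewrite d0 /= (le_lt_trans _ dr) // ler_norm.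
  move=> [x' d] /= [xx' /andP[d0 dr]] Ax' y Ay x'y.
  rewrite -ball_normE /= in xx'.
  rewrite (le_lt_trans (ler_distD (f x) _ _)) // [ltRHS]splitr ltrD //.
    rewrite distrC; apply: rP => //; rewrite -ball_normE /=.
    by rewrite (lt_trans xx') // ltr_pdivrMr // mulrDr mulr1 ltrDr.
  apply: rP => //; rewrite -ball_normE /=.
  rewrite (le_lt_trans (ler_distD x' _ _)) // [ltRHS]splitr ltrD //.
  exact: lt_trans x'y dr.
move=> d /= d0 dP; exists (d / 2); first by rewrite divr_gt0.
move=> x y Ax Ay xy; apply: (dP (d / 2)) => //=.
- by rewrite sub0r normrN gtr0_norm ?divr_gt0 // ltr_pdivrMr // mulrDr mulr1 ltrDr.
- by rewrite divr_gt0.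
Qed.

(** The scale [d] is fixed: only triples of diameter below [d] are constrained. *)
Definition cocycle V (A : set V) (d : R) (u : V -> V -> bool) :=
  forall x y z, A x -> A y -> A z -> `|x - y| < d -> `|y - z| < d -> `|x - z| < d ->
  u x y (+) u y z = u x z.

(** Here the scale is existential, so the class is only asked to vanish in the limit over all
    scales. The primitive [v] need not be continuous. *)
Definition coboundary V (A : set V) (u : V -> V -> bool) :=
  exists2 d : R, 0 < d & exists v : V -> bool,
  forall x y, A x -> A y -> `|x - y| < d -> u x y = v x (+) v y.

Lemma cocycle_refl V (A : set V) d u x : 0 < d -> cocycle A d u -> A x -> u x x = false.
Proof.
by move=> d0 /(_ x x x) + Ax; rewrite subrr normr0 => /(_ Ax Ax Ax d0 d0 d0); case: (u x x).
Qed.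

(* The primitive sums the cocycle along the discretised path [t |-> H t x]. *)
Lemma homotopy_coboundary V W (A : set V) (B : set W) (d : R) (u : W -> W -> bool)
    (H : R -> V -> W) :
  0 < d -> cocycle B d u ->
  (forall t x, 0 <= t <= 1 -> A x -> B (H t x)) ->
  (exists2 e : R, 0 < e & forall s t x y, 0 <= s <= 1 -> 0 <= t <= 1 -> A x -> A y ->
     `|s - t| < e -> `|x - y| < e -> `|H s x - H t y| < d) ->
  coboundary A (fun x y => u (H 0 x) (H 0 y) (+) u (H 1 x) (H 1 y)).
Proof.
move=> d0 cu HB [e e0 He].
have [N eN] : exists N : nat, N.+1%:R^-1 < e.
  by exists (Num.truncn e^-1); rewrite invf_plt ?posrE // truncnS_gt.
pose tau (j : nat) : R := j%:R / N.+1%:R.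
have tau01 j : (j <= N.+1)%N -> 0 <= tau j <= 1.
  by move=> jN; rewrite divr_ge0 //= ler_pdivrMr // mul1r ler_nat.
have tauS j : `|tau j - tau j.+1| < e.
  by rewrite -mulrBl -natr1 opprD addrA subrr sub0r mulN1r normrN gtr0_norm.
exists e => //; exists (fun x => \big[addb/false]_(j < N.+1) u (H (tau j) x) (H (tau j.+1) x)).
move=> x y Ax Ay xy.
have S m : (m <= N.+1)%N -> u (H 0 x) (H 0 y) (+) u (H (tau m) x) (H (tau m) y) =
   \big[addb/false]_(j < m) u (H (tau j) x) (H (tau j.+1) x) (+)
   \big[addb/false]_(j < m) u (H (tau j) y) (H (tau j.+1) y).
  elim: m => [|m IH] mN; first by rewrite !big_ord0 /tau mulr0n mul0r; case: (u _ _).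
  have {IH} := IH (ltnW mN).
  rewrite !big_ord_recr /=; have t1 := tau01 _ mN; have t0 := tau01 _ (ltnW mN).
  (* The square between two consecutive times is cut into two triangles: both sides equal [u] on the
     diagonal from [H (tau m) x] to [H (tau m.+1) y]. *)
  have step : u (H (tau m) x) (H (tau m) y) (+) u (H (tau m) y) (H (tau m.+1) y) =
     u (H (tau m) x) (H (tau m.+1) x) (+) u (H (tau m.+1) x) (H (tau m.+1) y).
    by rewrite !cu //; first [exact: HB | apply: He; rewrite ?subrr ?normr0].
  move: step (\big[_/_]_(_ < m) _) (\big[_/_]_(_ < m) _).
  move: (u (H 0 x) _) (u (H (tau m) x) _) (u (H (tau m) y) _) (u (H (tau m.+1) x) _).
  by move: (u (H (tau m) x) _) => [] [] [] [] [] //= _ [] [].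
by have := S _ (leqnn _); rewrite {1 2}/tau divff ?pnatr_eq0.
Qed.

(** Connectedness of the interval in uniform form: walk from 0 to 1 in equal steps shorter than
    [e]. *)
Lemma unit_interval_locally_constant (v : R -> bool) (e : R) : 0 < e ->
  (forall s t, 0 <= s <= 1 -> 0 <= t <= 1 -> `|s - t| < e -> v s = v t) -> v 0 = v 1.
Proof.
move=> e0 ve.
have [N eN] : exists N : nat, N.+1%:R^-1 < e.
  by exists (Num.truncn e^-1); rewrite invf_plt ?posrE // truncnS_gt.
suff S m : (m <= N.+1)%N -> v 0 = v (m%:R / N.+1%:R).
  by rewrite (S N.+1) // divff ?pnatr_eq0.
have I01 j : (j <= N.+1)%N -> 0 <= (j%:R / N.+1%:R : R) <= 1.
  by move=> jN; rewrite divr_ge0 //= ler_pdivrMr // mul1r ler_nat.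
elim: m => [|m IH] mN; first by rewrite mul0r.
rewrite IH ?(ltnW mN) //; apply: ve; rewrite ?I01 ?(ltnW mN) //.
by rewrite -mulrBl -natr1 opprD addrA subrr sub0r mulN1r normrN gtr0_norm.
Qed.

Lemma coboundaryD V (A : set V) u u' : coboundary A u -> coboundary A u' ->
  coboundary A (fun x y => u x y (+) u' x y).
Proof.
move=> [d d0 [v vP]] [d' d'0 [v' vP']]; exists (Num.min d d'); first by rewrite lt_min d0.
exists (fun x => v x (+) v' x) => x y Ax Ay; rewrite lt_min => /andP[xy xy'].
by rewrite vP // vP' // addbACA.
Qed.

Lemma coboundary_eq V (A : set V) u u' : (forall x y, A x -> A y -> u x y = u' x y) ->
  coboundary A u -> coboundary A u'.
Proof. by move=> uu' [d d0 [v vP]]; exists d => //; exists v => x y Ax Ay xy; rewrite -uu' ?vP. Qed.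

Lemma coboundary_comp V W (A : set V) (B : set W) (f : V -> W) u : unif_on A f ->
  (forall x, A x -> B (f x)) -> coboundary B u -> coboundary A (fun x y => u (f x) (f y)).
Proof.
move=> cf fAB [d d0 [v vP]]; have [e e0 eP] := cf _ d0; exists e => //.
by exists (v \o f) => x y Ax Ay xy; rewrite vP //; [exact: fAB|exact: fAB|exact: eP].
Qed.

End AlexanderSpanier.

(** * Straight-line homotopies *)

Section StraightLine.
Variable (R : realType).
Implicit Types V W : normedModType R.

(** The linear homotopy from [f] to [g] stays in [B]; the bound [M] on its speed makes it uniformly
    continuous in time as well as in space. *)
Lemma straight_line_coboundary V W (A : set V) (B : set W) d u (f g : V -> W) M :
  0 < d -> cocycle B d u -> unif_on A f -> unif_on A g ->
  (forall x, A x -> `|g x - f x| <= M) ->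
  (forall t x, 0 <= t <= 1 -> A x -> B (f x + t *: (g x - f x))) ->
  coboundary A (fun x y => u (f x) (f y) (+) u (g x) (g y)).
Proof.
move=> d0 cu cf cg fgM fgB.
have d40 : 0 < d / 4 by rewrite divr_gt0.
have [e1 e10 fe] := cf _ d40; have [e2 e20 ge] := cg _ d40.
have M0 : 0 < `|M| + 1 by rewrite ltr_wpDl.
(* A change of time moves the point by at most [d / 4]; a change of [x] contributes one quarter of
   [d] through [f] and two through [g - f]. *)
pose e := Num.min e1 (Num.min e2 (d / 4 / (`|M| + 1))).
have [e0 ee1 ee2 eM] : [/\ 0 < e, e <= e1, e <= e2 & e <= d / 4 / (`|M| + 1)].
  by rewrite !lt_min e10 e20 divr_gt0 // !ge_min !lexx !orbT.
apply: coboundary_eq (homotopy_coboundary (H := fun t x => f x + t *: (g x - f x)) d0 cu fgB _).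
  by move=> x y _ _; rewrite !scale0r !addr0 !scale1r !subrKC.
exists e => // s t x y s01 /andP[t0 t1] Ax Ay st xy.
have -> : f x + s *: (g x - f x) - (f y + t *: (g y - f y)) =
   (s - t) *: (g x - f x) + ((f x - f y) + t *: (g x - f x - (g y - f y))).
  move: (g x - f x) (g y - f y) => a b.
  by rewrite scalerBl scalerBr opprD addrACA [RHS]addrCA [s *: a - _ + _]addrA subrK.
have hf := fe _ _ Ax Ay (lt_le_trans xy ee1).
have hg := ge _ _ Ax Ay (lt_le_trans xy ee2).
have h1 : `|(s - t) *: (g x - f x)| <= d / 4.
  rewrite normrZ; apply: le_trans (_ : e * (`|M| + 1) <= _); last by rewrite -ler_pdivlMr.
  apply: ler_pM => //; first exact: ltW.
  by rewrite (le_trans (fgM _ Ax)) // (le_trans (ler_norm _)) // lerDl.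
have h2 : `|t *: (g x - f x - (g y - f y))| <= d / 4 + d / 4.
  rewrite normrZ ger0_norm //; apply: (@le_trans _ _ `|g x - f x - (g y - f y)|).
    by rewrite ler_piMl.
  have -> : g x - f x - (g y - f y) = (g x - g y) - (f x - f y)
    by rewrite !opprB [f y - g y]addrC addrACA [- f x + _]addrC.
  by rewrite (le_trans (ler_normB _ _)) // lerD // ltW.
apply: le_lt_trans (ler_normD _ _) _.
apply: le_lt_trans (lerD h1 (ler_normD _ _)) _.
lra.
Qed.

Lemma straight_line_const V (A : set V) (w : V -> bool) (e : R) a b :
  0 < e -> (forall x y, A x -> A y -> `|x - y| < e -> w x = w y) ->
  (forall t, 0 <= t <= 1 -> A (a + t *: (b - a))) -> w a = w b.
Proof.
move=> e0 we ab.
have M0 : 0 < `|b - a| + 1 by rewrite ltr_wpDl.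
have := @unit_interval_locally_constant R (fun t => w (a + t *: (b - a))) (e / (`|b - a| + 1)).
rewrite scale0r addr0 scale1r subrKC; apply; first by rewrite divr_gt0.
move=> s t s01 t01 st; apply: we; [exact: ab|exact: ab|].
rewrite [a + s *: _]addrC addrKA -scalerBl normrZ.
apply: le_lt_trans (_ : `|s - t| * (`|b - a| + 1) < _); last by rewrite -ltr_pdivlMr.
by rewrite ler_wpM2l // lerDl.
Qed.
End StraightLine.

(** * Linear algebra over the field with two elements *)

Definition dot3 (a b : nat -> bool) :=
  (a 0%N && b 0%N) (+) (a 1%N && b 1%N) (+) (a 2%N && b 2%N).

Definition comb3 (T : Type) (n : nat -> bool) (u : nat -> T -> T -> bool) x y :=
  dot3 n (fun j => u j x y).

Lemma dot3D n a b : dot3 n (fun j => a j (+) b j) = dot3 n a (+) dot3 n b.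
Proof. by rewrite /dot3 !andb_addr (addbACA (n 0%N && a 0%N)) addbACA. Qed.

Lemma eq_dot3 n a b : (forall j, (j < 3)%N -> a j = b j) -> dot3 n a = dot3 n b.
Proof. by move=> ab; rewrite /dot3 !ab. Qed.

Lemma comb3_cocycle (R : realType) (V : normedModType R) (A : set V) d
    (u : nat -> V -> V -> bool) n :
  (forall j, cocycle A d (u j)) -> cocycle A d (comb3 n u).
Proof.
move=> cu x y z Ax Ay Az xy yz xz; rewrite /comb3 -dot3D.
by apply: eq_dot3 => j _; exact: cu.
Qed.

(** Two linear equations in three unknowns have a nonzero solution; the candidates tried are the
    seven nonzero vectors. *)
Lemma orthogonal_pair (p q : nat -> bool) : exists n : nat -> bool,
  [&& [|| n 0%N, n 1%N | n 2%N], ~~ dot3 n p & ~~ dot3 n q].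
Proof.
pose N (x y z : bool) := fun j : nat => match j with 0%N => x | 1%N => y | _ => z end.
rewrite /dot3.
case: (p 0%N); case: (p 1%N); case: (p 2%N); case: (q 0%N); case: (q 1%N); case: (q 2%N);
 solve [ exists (N true false false); by [] | exists (N false true false); by []
       | exists (N false false true); by [] | exists (N true true false); by []
       | exists (N true false true); by [] | exists (N false true true); by []
       | exists (N true true true); by [] ].
Qed.

(** Three points of a three-dimensional space lie in a common affine plane: [n] is its normal and
    [t] the value on it. So either the vectors [dv z] lie in a plane, or they take four distinct
    values. *)
Lemma affine_or_four (T : finType) (E : pred T) (D : nat -> T -> bool) :
  (exists (n : nat -> bool) t, [|| n 0%N, n 1%N | n 2%N] /\
     forall z, E z -> dot3 n (D^~ z) = t) \/
  (exists z : 'I_4 -> T, (forall i, E (z i)) /\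
     forall i j, i != j -> exists k, D k (z i) != D k (z j)).
Proof.
pose dv z := (D 0%N z, D 1%N z, D 2%N z).
have aff z1 z2 z3 : (forall z, E z -> dv z \in [:: dv z1; dv z2; dv z3]) ->
    exists (n : nat -> bool) t, [|| n 0%N, n 1%N | n 2%N] /\
      forall z, E z -> dot3 n (D^~ z) = t.
  move=> Ez; have [n /and3P[n0 n2 n3]] := orthogonal_pair
    (fun j => D j z1 (+) D j z2) (fun j => D j z1 (+) D j z3).
  move: n2 n3; rewrite !dot3D !negb_add => /eqP n2 /eqP n3.
  exists n, (dot3 n (D^~ z1)); split => // z /Ez; rewrite !inE => /or3P[]/eqP[].
  - by rewrite /dot3 => -> -> ->.
  - by rewrite n2 /dot3 => -> -> ->.
  - by rewrite n3 /dot3 => -> -> ->.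
have [z1 Ez1|E0] := pickP E; last first.
  by left; exists (fun=> true), true; split => // z; rewrite E0.
have [z2 /andP[Ez2 z21]|E2] := pickP (fun z => E z && (dv z != dv z1)); last first.
  (* Repeating a point covers the cases of fewer than three values. *)
  left; apply: (aff z1 z1 z1) => z Ez; rewrite !inE.
  by have := E2 z; rewrite Ez /= => /negbFE ->.
have [z3 /and3P[Ez3 z31 z32]|E3] :=
  pickP (fun z => [&& E z, dv z != dv z1 & dv z != dv z2]); last first.
  left; apply: (aff z1 z2 z2) => z Ez; rewrite !inE.
  by have := E3 z; rewrite Ez /=; case: (_ == dv z1) => //= /negbFE ->.
have [z4 /and4P[Ez4 z41 z42 z43]|E4] :=
  pickP (fun z => [&& E z, dv z != dv z1, dv z != dv z2 & dv z != dv z3]); last first.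
  left; apply: (aff z1 z2 z3) => z Ez; rewrite !inE.
  have := E4 z; rewrite Ez /=; case: (_ == dv z1) => //=; case: (_ == dv z2) => //=.
  by move=> /negbFE ->.
right; exists (tnth [tuple z1; z2; z3; z4]); split.
  by move=> i; case: i => -[|[|[|[|]]]].
have dvk a b : dv a != dv b -> exists k, D k a != D k b.
  move=> ab; case: (eqVneq (D 0%N a) (D 0%N b)) => [h0|]; last by exists 0%N.
  case: (eqVneq (D 1%N a) (D 1%N b)) => [h1|]; last by exists 1%N.
  by exists 2%N; apply: contraNneq ab => h2; rewrite /dv h0 h1 h2.
move=> i j ij; apply: dvk; move: ij.
case: i => -[|[|[|[|//]]]] ?; case: j => -[|[|[|[|//]]]] ? //= _; rewrite !(tnth_nth z1) //= eq_sym //.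
Qed.

(** * Three independent classes on the wedge *)

Lemma coord_le_norm (R : realType) n (x : 'rV[R]_n) i : `|x ord0 i| <= `|x|.
Proof.
rewrite [leRHS]/normr /= mx_normrE; apply/bigmax_geP; right => /=.
by exists (ord0, i).
Qed.

Lemma norm_lt_coord (R : realType) n (x : 'rV[R]_n) e : 0 < e ->
  (forall i, `|x ord0 i| < e) -> `|x| < e.
Proof.
move=> e0 xe; rewrite [ltLHS]/normr /= mx_normrE; apply/bigmax_ltP; split => // -[i j] _ /=.
by rewrite ord1.
Qed.

Lemma norm_le_coord (R : realType) n (x : 'rV[R]_n) e : 0 <= e ->
  (forall i, `|x ord0 i| <= e) -> `|x| <= e.
Proof.
move=> e0 xe; rewrite [leLHS]/normr /= mx_normrE; apply/bigmax_leP; split => // -[i j] _ /=.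
by rewrite ord1.
Qed.

Lemma closed_fun_eq (R : realType) (T : topologicalType) (f : T -> R) c :
  continuous f -> closed [set x | f x = c].
Proof. by move=> cf; apply: (@preimage_closed _ _ f [set y | y = c]) => [x _|]; [exact: cf|exact: closed_eq]. Qed.

Lemma closed_fun_ge0 (R : realType) (T : topologicalType) (f : T -> R) :
  continuous f -> closed [set x | 0 <= f x].
Proof. by move=> cf; apply: (@preimage_closed _ _ f [set y | 0 <= y]) => [x _|]; [exact: cf|exact: closed_ge]. Qed.

Section Wedge.
Variables (R : realType).
Implicit Types p q : 'rV[R]_2.

Local Notation px p := (p ord0 ord0).
Local Notation py p := (p ord0 (lift ord0 ord0)).

Lemma wedge_circles_compact k : compact (wedge_circles R k).
Proof.
have -> : wedge_circles R k = \bigcup_(j in [set j | (1 <= j <= k)%N])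
   [set p | (px p - j%:R) ^+ 2 + (py p) ^+ 2 = j%:R ^+ 2].
  apply/seteqP; split => p /=.
    by move=> [j [jk pj]]; exists j.
  by move=> [j jk pj]; exists j.
apply: bounded_closed_compact; last first.
  apply: closed_bigcup.
    apply: (@sub_finite_set _ _ `I_k.+1); last exact: finite_II.
    by move=> j /= /andP[].
  move=> j _; apply: closed_fun_eq => p.
  have c2 (f : 'rV[R]_2 -> R) : {for p, continuous f} -> {for p, continuous (fun p => f p ^+ 2)}.
    by move=> cf; exact: (@continuous_comp _ _ _ f (fun y : R => y ^+ 2) p cf (@exprn_continuous R 2 (f p))).
  have C1 : {for p, continuous (fun p : 'rV[R]_2 => px p - j%:R)}.
    have C0 : {for p, continuous (fun p : 'rV[R]_2 => px p)} by exact: coord_continuous.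
    exact: (continuousB C0 (@cst_continuous _ _ (j%:R : R) p)).
  have C2 : {for p, continuous (fun p : 'rV[R]_2 => py p)} by exact: coord_continuous.
  exact: (continuousD (c2 _ C1) (c2 _ C2)).
exists (k%:R *+ 2); split; first by rewrite num_real.
move=> M kM p /= [j /andP[j1 jk] pE]; apply: norm_le_coord.
  by rewrite (le_trans _ (ltW kM)) // mulrn_wge0.
have jk' : j%:R <= k%:R :> R by rewrite ler_nat.
have j0 : 0 < j%:R :> R by rewrite ltr0n.
have : `|px p - j%:R| <= j%:R /\ `|py p| <= j%:R.
  by split; rewrite -(ler_pXn2r (ltn0Sn 1)) ?nnegrE // -normrX ger0_norm ?sqr_ge0 // -pE
    ?lerDl ?lerDr ?sqr_ge0.
rewrite !ler_norml => -[/andP[? ?] /andP[? ?]] i.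
rewrite ler_norml; case: (unliftP ord0 i) => [i' ->|->]; last by apply/andP; split; lra.
by rewrite (ord1 i'); apply/andP; split; lra.
Qed.

(* Dual to the point (2j+1, 0), which lies inside the circle of radius
   [i + 1] exactly when [j <= i]: counts the crossings of the ray issued from
   it to the right. *)
Definition ray_cut (j : nat) p q : bool :=
  [&& j.*2.+1%:R < px p, j.*2.+1%:R < px q & (0 <= py p) (+) (0 <= py q)].

(** On the circle of radius [i], [y^2 = x (2i - x)]. If [i <= j], the circle stays left of the
    strip; if [j < i], both factors exceed 3/4 in the strip. *)
Lemma wedge_circles_avoid k j p : wedge_circles R k p ->
  `|px p - j.*2.+1%:R| < 4^-1 -> 2^-1 < `|py p|.
Proof.
move=> [i [_ pE]]; rewrite ltr_norml => /andP[x1 x2].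
have j1 : 1 <= j.*2.+1%:R :> R by rewrite ler1n.
have yE : (py p) ^+ 2 = px p * (i.*2%:R - px p).
  by rewrite -mul2n natrM; move: pE; rewrite !expr2; lra.
have ij : (j < i)%N.
  rewrite ltnNge; apply/negP => ij.
  have : i.*2%:R + 1 <= j.*2.+1%:R :> R by rewrite natr1 ler_nat ltnS leq_double.
  by move: (sqr_ge0 (py p)); rewrite yE; nra.
have : j.*2.+1%:R + 1 <= i.*2%:R :> R by rewrite natr1 ler_nat -doubleS leq_double.
move=> ij'; rewrite ltNge; apply/negP; rewrite ler_norml => /andP[y1 y2].
by move: yE; rewrite expr2; nra.
Qed.

(** If [p] or [q] is near the vertical line through the source of the ray, all three ordinates have
    the same sign and every term vanishes. Otherwise the three points are on one side of the line,
    where the cochain is zero or the difference of the signs of the ordinates. *)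
Lemma ray_cut_cocycle k j : cocycle (wedge_circles R k) 4^-1 (ray_cut j).
Proof.
have key a b : wedge_circles R k a -> `|px a - j.*2.+1%:R| < 4^-1 -> `|a - b| < 4^-1 ->
    (0 <= py a) = (0 <= py b).
  move=> Wa aj ab; have := wedge_circles_avoid Wa aj.
  have := le_lt_trans (coord_le_norm _ (lift ord0 ord0)) ab; rewrite !mxE ltr_norml => /andP[? ?].
  rewrite lter_normr.
  by move=> /orP[?|?]; apply/idP/idP => ?; lra.
move=> p q r Wp Wq Wr pq qr pr.
have := le_lt_trans (coord_le_norm _ ord0) pq; rewrite !mxE ltr_norml => /andP[? ?].
have := le_lt_trans (coord_le_norm _ ord0) qr; rewrite !mxE ltr_norml => /andP[? ?].
have := le_lt_trans (coord_le_norm _ ord0) pr; rewrite !mxE ltr_norml => /andP[? ?].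
set m := (j.*2.+1)%:R in key *.
have same : (0 <= py p) = (0 <= py q) -> (0 <= py q) = (0 <= py r) ->
    ray_cut j p q (+) ray_cut j q r = ray_cut j p r.
  by rewrite /ray_cut => -> ->; case: (0 <= py r) => /=; rewrite !andbF.
have [np|fp] := ltP `|px p - m| 4^-1.
  by apply: same; [exact: key | rewrite -(key p q) // -(key p r)].
have [nq|fq] := ltP `|px q - m| 4^-1.
  by apply: same; [rewrite (key q p) // distrC | exact: key].
rewrite /ray_cut -/m.
have [mp|pm] := ltP m (px p); have [mq|qm] := ltP m (px q); have [mr|rm] := ltP m (px r) => //=;
  rewrite ?addbF ?addFb //.
all: move: fp fq; rewrite !ler_normr.
all: try by move=> /orP[] ? /orP[] ?; lra.
by case: (0 <= py p); case: (0 <= py q); case: (0 <= py r).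
Qed.

Let pt (a b : R) : 'rV[R]_2 := \row_(i < 2) (if i == ord0 then a else b).

Let pxE a b : px (pt a b) = a. Proof. by rewrite mxE. Qed.
Let pyE a b : py (pt a b) = b. Proof. by rewrite mxE. Qed.

Let pt_dist (a b c d e : R) : `|a - c| < e -> `|b - d| < e -> `|pt a b - pt c d| < e.
Proof.
move=> ac bd; apply: norm_lt_coord; first exact: le_lt_trans (normr_ge0 _) ac.
by move=> i; rewrite !mxE; case: ifP.
Qed.

(** The upper half of the circle of radius [i + 1], as a function of the abscissa. *)
Let height (i : nat) (s : R) := Num.sqrt (s * (i.*2.+2%:R - s)).

Let height_cont i : continuous (height i).
Proof.
move=> s; apply: (@continuous_comp _ _ _ (fun s : R => s * (i.*2.+2%:R - s)) (@Num.sqrt R)); last exact: sqrt_continuous.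
have C0 : {for s, continuous (fun s : R => s)} by exact: cvg_id.
have C1 : {for s, continuous (fun s : R => i.*2.+2%:R - s)}.
  exact: (continuousB (@cst_continuous _ _ (i.*2.+2%:R : R) s) C0).
exact: (continuousM C0 C1).
Qed.

Let height_on k i (sg : bool) s : (i < k)%N -> 0 <= s <= i.*2.+2%:R ->
  wedge_circles R k (pt s (if sg then height i s else - height i s)).
Proof.
move=> ik /andP[s0 s1]; exists i.+1; split => //; rewrite pxE pyE.
have -> : (if sg then height i s else - height i s) ^+ 2 = s * (i.*2.+2%:R - s).
  by rewrite (fun_if (fun x => x ^+ 2)) sqrrN if_same sqr_sqrtr // mulr_ge0 // subr_ge0.
by rewrite -doubleS -mul2n natrM !expr2; lra.
Qed.

(** The sum is the period of the class along the circle of radius [i + 1], which a coboundary makes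
    zero: the ray of [ray_cut j] meets this circle once if [j <= i], and not at all otherwise. *)
Lemma circle_period k i (n : nat -> bool) : (i < 3)%N -> (i < k)%N ->
  coboundary (wedge_circles R k) (comb3 n ray_cut) ->
  \big[addb/false]_(j < i.+1) n j = false.
Proof.
move=> i3 ik [d d0 [v vP]].
set D := i.*2.+2%:R : R.
have D2 : 2 <= D by rewrite ler_nat.
(* The slope of [height i] is unbounded at both ends, so the modulus comes from compactness. *)
have [e' e'0 he'] : exists2 e', 0 < e' & forall s t, 0 <= s <= D -> 0 <= t <= D ->
    `|s - t| < e' -> `|height i s - height i t| < d.
  have cI : compact [set` `[0, D]] by exact: segment_compact.
  have [|e e0 eP] := compact_unif_on cI _ d0 (f := height i : R^o -> R^o).
    exact: continuous_subspaceT (@height_cont i).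
  by exists e => // s t s0 t0; apply: eP; rewrite /= in_itv.
pose e := Num.min e' (Num.min d 1).
have [e0 ee' ed e1] : [/\ 0 < e, e <= e', e <= d & e <= 1].
  by rewrite !lt_min e'0 d0 ltr01 !ge_min !lexx !orbT.
pose P (sg : bool) (s : R) := pt s (if sg then height i s else - height i s).
have vPP sg s t : 0 <= s <= D -> 0 <= t <= D -> `|s - t| < e ->
    comb3 n ray_cut (P sg s) (P sg t) = v (P sg s) (+) v (P sg t).
  move=> s0 t0 st; apply: vP; try exact: height_on.
  apply: pt_dist; first exact: lt_le_trans st ed.
  case: sg; last rewrite -opprD normrN; apply: he' => //; exact: lt_le_trans st ee'.
have xorF (a b : bool) : a (+) b = false -> a = b by case: a; case: b.
have up : v (P true 0) = v (P true D).
  pose w t := v (P true (D * t)).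
  have := @unit_interval_locally_constant R w (e / D).
  rewrite /w mulr0 mulr1; apply; first by rewrite divr_gt0 //; lra.
  move=> s t /andP[s0 s1] /andP[t0 t1] st; apply: xorF.
  have h0 s' : (0 <= height i s') = true by rewrite sqrtr_ge0.
  rewrite -vPP ?mulr_ge0 ?ler_piMr //; try lra.
    by rewrite /comb3 /dot3 /ray_cut /P !pyE !h0 /= !andbF.
  rewrite -mulrBr normrM ger0_norm; last lra.
  by rewrite mulrC -ltr_pdivlMr //; lra.
(* The lower arc is cut short by [r] at both ends, since its endpoints have ordinate 0 and count as
   upper points. As [r <= 1/2], [D - r] remains to the right of [2j + 1] for all [j <= i]. *)
pose r := e / 2.
have [r0 re r1]: [/\ 0 < r, r < e & r <= 2^-1].
  by split; rewrite /r ?divr_gt0 // ?ltr_pdivrMr ?ler_pdivrMr //; lra.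
have low : v (P false r) = v (P false (D - r)).
  pose w t := v (P false (r + (D - r *+ 2) * t)).
  have := @unit_interval_locally_constant R w (e / (D - r *+ 2)).
  have Do : 0 < D - r *+ 2 by lra.
  have -> : D - r = r + (D - r *+ 2) by lra.
  rewrite /w mulr0 mulr1 addr0; apply; first by rewrite divr_gt0.
  move=> s t s01 t01 st; apply: xorF.
  have b s' : 0 <= s' <= 1 -> r <= r + (D - r *+ 2) * s' <= D - r.
    move=> /andP[? ?]; have : 0 <= (D - r *+ 2) * s' <= D - r *+ 2.
      by rewrite mulr_ge0 ?ler_piMr // ltW.
    by move=> /andP[? ?]; lra.
  have h0 s' : r <= s' <= D - r -> (0 <= - height i s') = false.
    move=> /andP[? ?]; apply: negbTE; rewrite -ltNge oppr_lt0 sqrtr_gt0 mulr_gt0 //; lra.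
  have /andP[b1 b2] := b _ s01; have /andP[b3 b4] := b _ t01.
  rewrite -vPP; first by rewrite /comb3 /dot3 /ray_cut /P !pyE !h0 ?b // !andbF.
  - by apply/andP; split; lra.
  - by apply/andP; split; lra.
  rewrite [r + _]addrC addrKA -mulrBr normrM ger0_norm; last lra.
  by rewrite mulrC -ltr_pdivlMr.
have Pfalse s : height i s = 0 -> P false s = P true s by rewrite /P => ->; rewrite oppr0.
have z0 : v (P true 0) = v (P false r).
  rewrite -Pfalse; last by rewrite /height mul0r sqrtr0.
  apply: xorF; rewrite -vPP; last by rewrite sub0r normrN gtr0_norm.
  - have c j : ray_cut j (P false 0) (P false r) = false by rewrite /ray_cut pxE ltNge ler0n.
    by rewrite /comb3 /dot3 !c !andbF.
  - by rewrite lexx /=; lra.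
  - by apply/andP; split; lra.
(* The edge from the right end to the lower arc is the only one that can cross a ray. *)
have cD j : ray_cut j (P true D) (P false (D - r)) = (j <= i)%N.
  rewrite /ray_cut !pxE !pyE sqrtr_ge0 leNgt oppr_lt0 sqrtr_gt0 mulr_gt0; [|lra|lra].
  rewrite /= andbT /D ltr_nat.
  have [ji|ij] := leqP j i.
    have -> : (j.*2.+1 < i.*2.+2)%N by rewrite !ltnS leq_double.
    have : j.*2.+1%:R + 1 <= D by rewrite natr1 ler_nat !ltnS leq_double.
    by rewrite /= -/D; lra.
  by rewrite [X in X && _]ltnS leqNgt ltnS ltn_double ij.
have : comb3 n ray_cut (P true D) (P false (D - r)) = false.
  have -> : P true D = P false D by rewrite -Pfalse // /height subrr mulr0 sqrtr0.
  rewrite vPP; first by rewrite Pfalse -?low -?z0 ?up ?addbb // /height subrr mulr0 sqrtr0.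
  - by apply/andP; split; lra.
  - by apply/andP; split; lra.
  by rewrite opprD opprK addrA subrr add0r gtr0_norm.
rewrite /comb3 /dot3 !cD.
by case: i i3 {ik D D2 he' P vPP up xorF r r0 re r1 low Pfalse z0 cD} => [|[|[|//]]] _;
  rewrite ?big_ord_recr big_ord0 /= ?andbT ?andbF ?addbF.
Qed.

(** The matrix of periods over the circles of radius 1, 2, 3 is unitriangular. *)
Lemma ray_cut_independent k (n : nat -> bool) : (3 <= k)%N ->
  coboundary (wedge_circles R k) (comb3 n ray_cut) -> [/\ n 0%N = false, n 1%N = false & n 2%N = false].
Proof.
move=> k3 cob.
have := circle_period (i := 0) isT (ltn_trans _ k3) cob.
have := circle_period (i := 1) isT (ltn_trans _ k3) cob.
have := circle_period (i := 2) isT k3 cob.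
rewrite !big_ord_recr !big_ord0 /= => n2 n1 n0; move: n2 (n1 isT) (n0 isT).
by case: (n 0%N); case: (n 1%N); case: (n 2%N).
Qed.
End Wedge.

(** * Independence complexes of bipartite graphs *)

Section Weight.
Variables (R : realType) (n : nat).
Implicit Types (P : pred 'I_n) (x y : 'rV[R]_n).

Definition weight P x := \sum_(i | P i) x ord0 i.

Lemma weightD P x y : weight P (x + y) = weight P x + weight P y.
Proof. by rewrite /weight -big_split; apply: eq_bigr => i _; rewrite mxE. Qed.

Lemma weightZ P (t : R) x : weight P (t *: x) = t * weight P x.
Proof. by rewrite /weight mulr_sumr; apply: eq_bigr => i _; rewrite mxE. Qed.

Lemma weightB P x y : weight P (x - y) = weight P x - weight P y.
Proof. by rewrite -scaleN1r weightD weightZ mulN1r. Qed.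

Lemma weight_segment P x y (t : R) :
  weight P (x + t *: (y - x)) = weight P x + t * (weight P y - weight P x).
Proof. by rewrite weightD weightZ weightB. Qed.

Lemma weight_delta P (a : 'I_n) : weight P (delta_mx ord0 a) = (P a)%:R.
Proof.
rewrite /weight; case Pa : (P a).
  rewrite (bigD1 a) //= mxE !eqxx big1 ?addr0 // => i /andP[_ ia].
  by rewrite mxE (negbTE ia) andbF.
rewrite big1 // => i Pi; rewrite mxE eqxx /=; case: eqP => // ia.
by rewrite ia Pa in Pi.
Qed.

Lemma weightC P x : weight xpredT x = weight P x + weight (predC P) x.
Proof. exact: bigID. Qed.

Lemma weight_norm P x : `|weight P x| <= n%:R * `|x|.
Proof.
rewrite (le_trans (ler_norm_sum _ _ _)) //.
apply: le_trans (_ : \sum_(i | P i) `|x| <= _); first by apply: ler_sum => i _; exact: coord_le_norm.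
rewrite sumr_const -[leLHS]mulr_natl ler_wpM2r //.
by rewrite ler_nat -[leqRHS]card_ord max_card.
Qed.

Lemma weight_continuous P : continuous (weight P).
Proof.
apply: (@continuous_big R 'I_n +%R 0 P (@add_continuous R^o) 'rV[R]_n (index_enum _)
  (fun i x => x ord0 i)).
by move=> i _; exact: coord_continuous.
Qed.

Lemma weight_ge0 P x : (forall i, 0 <= x ord0 i) -> 0 <= weight P x.
Proof. by move=> x0; apply: sumr_ge0. Qed.

Lemma weight_neq0 P x : weight P x != 0 -> exists2 i, P i & x ord0 i != 0.
Proof.
move=> wx; have [i /andP[Pi xi]|none] := pickP (fun i => P i && (x ord0 i != 0)).
  by exists i.
case/negP: wx; rewrite /weight big1 // => i Pi.
by have := none i; rewrite Pi /= => /negbFE/eqP.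
Qed.
End Weight.

Section Realization.
Variables (R : realType) (n : nat) (e : rel 'I_n).
Local Notation X := (indep_realization R e).

(** Independence of the support becomes a system of quadratic equations, which is a closed
    condition; the support is nonempty because the total weight is 1. *)
Lemma indep_realizationP (x : 'rV[R]_n) : X x <->
  [/\ forall i, 0 <= x ord0 i, weight xpredT x = 1 &
      forall i j, e i j -> x ord0 i * x ord0 j = 0].
Proof.
split=> [[x0 [x1 [_ ind]]]|[x0 x1 ind]].
  split=> // i j eij; apply/eqP; rewrite mulf_eq0; apply: contraPT eij.
  by rewrite negb_or => /andP[xi xj]; apply/negP; apply: ind; rewrite inE.
split=> //; split; first exact: x1.
split=> [|i j].
  have [i _ xi] : exists2 i, xpredT i & x ord0 i != 0.
    by apply: weight_neq0; rewrite x1 oner_neq0.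
  by apply/set0Pn; exists i; rewrite inE.
rewrite !inE => xi xj; apply/negP => /ind/eqP.
by rewrite mulf_eq0 (negbTE xi) (negbTE xj).
Qed.

Lemma indep_coord_le1 (x : 'rV[R]_n) i : X x -> 0 <= x ord0 i <= 1.
Proof.
move=> /indep_realizationP[x0 x1 _]; rewrite x0 /= -x1 /weight (bigD1 i) //= lerDl.
exact: sumr_ge0.
Qed.

Lemma indep_norm_le1 (x : 'rV[R]_n) : X x -> `|x| <= 1.
Proof.
move=> Xx; apply: norm_le_coord => // i.
by have /andP[x0 x1] := indep_coord_le1 i Xx; rewrite ger0_norm.
Qed.

Lemma indep_realization_compact : compact X.
Proof.
apply: bounded_closed_compact.
  exists 1; split; first by rewrite num_real.
  by move=> M M1 x /indep_norm_le1 x1 /=; rewrite (le_trans x1) // ltW.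
have -> : X = (\bigcap_i [set x : 'rV[R]_n | 0 <= x ord0 i]) `&`
   ([set x : 'rV[R]_n | weight xpredT x = 1] `&`
    \bigcap_(p in [set p : 'I_n * 'I_n | e p.1 p.2])
       [set x : 'rV[R]_n | x ord0 p.1 * x ord0 p.2 = 0]).
  apply/seteqP; split => x.
    move=> /indep_realizationP[x0 x1 ind]; split; first by move=> i _; exact: x0.
    by split=> // -[i j]; exact: ind.
  move=> [x0 [x1 ind]]; apply/indep_realizationP; split => //; first by move=> i; exact: x0.
  by move=> i j eij; exact: (ind (i, j)).
have cc i : continuous (fun x : 'rV[R]_n => x ord0 i) by exact: coord_continuous.
apply: closedI; first by apply: closed_bigI => i _; apply: closed_fun_ge0; exact: cc.
apply: closedI; first by apply: closed_fun_eq; exact: weight_continuous.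
apply: closed_bigI => -[i j] _; apply: closed_fun_eq => x /=.
exact: (continuousM (cc i x) (cc j x)).
Qed.

(** As coordinates are nonnegative, the quadratic hypothesis says that the union of the two supports
    is independent, and the segment is supported there. *)
Lemma indep_segment (x y : 'rV[R]_n) (t : R) : 0 <= t <= 1 ->
  (forall i, 0 <= x ord0 i) -> (forall i, 0 <= y ord0 i) ->
  weight xpredT x = 1 -> weight xpredT y = 1 ->
  (forall i j, e i j -> (x ord0 i + y ord0 i) * (x ord0 j + y ord0 j) = 0) ->
  X (x + t *: (y - x)).
Proof.
move=> /andP[t0 t1] x0 y0 x1 y1 ind.
have zE i : (x + t *: (y - x)) ord0 i = (1 - t) * x ord0 i + t * y ord0 i.
  by rewrite !mxE; ring.
have t1' : 0 <= 1 - t by rewrite subr_ge0.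
have zero i : x ord0 i + y ord0 i = 0 -> (x + t *: (y - x)) ord0 i = 0.
  move=> /eqP; rewrite paddr_eq0 // => /andP[/eqP xi /eqP yi].
  by rewrite zE xi yi !mulr0 addr0.
apply/indep_realizationP; split => [i||i j /ind/eqP].
- by rewrite zE addr_ge0 // mulr_ge0.
- by rewrite weight_segment x1 y1 subrr mulr0 addr0.
by rewrite mulf_eq0 => /orP[]/eqP/zero ->; rewrite ?mul0r ?mulr0.
Qed.

Lemma indep_face_segment (x y : 'rV[R]_n) (t : R) : 0 <= t <= 1 ->
  X x -> (forall i, 0 <= y ord0 i) -> weight xpredT y = 1 ->
  (forall i, x ord0 i = 0 -> y ord0 i = 0) -> X (x + t *: (y - x)).
Proof.
move=> t01 /indep_realizationP[x0 x1 ind] y0 y1 xy; apply: indep_segment => // i j /ind/eqP.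
by rewrite mulf_eq0 => /orP[]/eqP xi; rewrite xi (xy _ xi) addr0 ?mul0r ?mulr0.
Qed.

End Realization.

(** * The two contractible halves *)

Section Heavy.
Variables (R : realType) (n : nat) (e : rel 'I_n).
Local Notation X := (indep_realization R e).

(** A threshold below 1/2 lets the halves for [P] and its complement overlap with a margin; being
    positive, it keeps division by the weight uniformly continuous. *)
Definition heavy (P : pred 'I_n) : set 'rV[R]_n := [set x | X x /\ 3^-1 <= weight P x].

Definition face_proj (P : pred 'I_n) (x : 'rV[R]_n) : 'rV[R]_n :=
  \row_i (if P i then x ord0 i / weight P x else 0).

Lemma face_proj_ge0 P x i : X x -> 0 <= face_proj P x ord0 i.
Proof.
move=> /indep_realizationP[x0 _ _]; rewrite mxE; case: ifP => // _.
by rewrite divr_ge0 ?weight_ge0.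
Qed.

Lemma weight_face_proj P x : weight P x != 0 -> weight xpredT (face_proj P x) = 1.
Proof.
move=> Px; rewrite (weightC P) [X in _ + X]big1 => [|i /negbTE Pi]; last by rewrite mxE Pi.
rewrite addr0 -[RHS](divff Px) mulr_suml; apply: eq_bigr => i Pi.
by rewrite mxE Pi.
Qed.

Lemma face_proj_unif_on P : unif_on (heavy P) (face_proj P).
Proof.
(* The factor 9 bounds [s^-1 * t^-1]; [n] accounts for the change of weight and 1 for that of the
   coordinate. *)
move=> eps eps0; pose d := eps / (9 * (n%:R + 1)).
have n0 : 0 <= n%:R :> R by [].
have d0 : 0 < d by rewrite divr_gt0 // mulr_gt0 // ltr_wpDl.
exists d => // x y [Xx x3] [Xy y3] xy.
apply: norm_lt_coord => // i; rewrite !mxE; case: ifP => _; last by rewrite subrr normr0.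
set s := weight P x in x3 *; set t := weight P y in y3 *.
have [s0 t0] : 0 < s /\ 0 < t by split; lra.
have st : `|s - t| <= n%:R * d.
  rewrite -weightB (le_trans (weight_norm _ _)) // ler_wpM2l // ltW //.
have ab : `|x ord0 i - y ord0 i| < d.
  by have := le_lt_trans (coord_le_norm (x - y) i) xy; rewrite !mxE.
have /andP[a0 a1] := indep_coord_le1 i Xx.
have t1 : t <= 1.
  have /indep_realizationP[y0 <- _] := Xy; rewrite (weightC P) lerDl weight_ge0 //.
set a := x ord0 i in ab a0 a1 *; set b := y ord0 i in ab *.
have -> : a / s - b / t = (s^-1 * t^-1) * (a * (t - s) + s * (a - b)).
  by field; rewrite !gt_eqF.
have s1 : s <= 1.
  have /indep_realizationP[x0 <- _] := Xx; rewrite (weightC P) lerDl weight_ge0 //.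
rewrite normrM; have -> : `|s^-1 * t^-1| = s^-1 * t^-1 by rewrite ger0_norm // mulr_ge0 // invr_ge0 ltW.
have h1 : s^-1 * t^-1 <= 9.
  have -> : 9 = 3 * 3 :> R by ring.
  by apply: ler_pM; rewrite ?invr_ge0 ?(ltW s0) ?(ltW t0) // invf_ple ?posrE.
have h2 : `|a * (t - s) + s * (a - b)| < d * (n%:R + 1).
  apply: le_lt_trans (ler_normD _ _) _; rewrite !normrM [`|t - s|]distrC.
  rewrite (ger0_norm a0) (gtr0_norm s0).
  have := ler_piMl (normr_ge0 (s - t)) a1; have := ler_piMl (normr_ge0 (a - b)) s1.
  by rewrite mulrDr mulr1; lra.
apply: le_lt_trans (_ : 9 * `|a * (t - s) + s * (a - b)| < _); first by rewrite ler_wpM2r.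
apply: lt_le_trans (_ : 9 * (d * (n%:R + 1)) <= _); first by rewrite ltr_pM2l.
by rewrite /d mulrCA divfK // gt_eqF // mulr_gt0 // ltr_wpDl.
Qed.

(* First push the mass onto [P], then contract the simplex spanned by [P]. *)
Lemma heavy_coboundary (P : pred 'I_n) d u :
  0 < d -> (forall i j, e i j -> ~~ (P i && P j)) -> cocycle X d u ->
  coboundary (heavy P) u.
Proof.
move=> d0 Pind cu.
have [a Pa|P0] := pickP P; last first.
  exists 1 => //; exists (fun=> false) => x y [_ x3].
  by move: x3; rewrite /weight big_pred0 // => ?; exfalso; lra.
have heavy0 x : heavy P x -> weight P x != 0 by move=> [_ x3]; rewrite gt_eqF //; lra.
pose va : 'rV[R]_n := delta_mx ord0 a.
have va0 i : 0 <= va ord0 i by rewrite mxE.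
have va1 : weight xpredT va = 1 by rewrite weight_delta.
have t1 : 0 <= (1 : R) <= 1 by rewrite ler01 lexx.
have Xproj x : heavy P x -> X (face_proj P x).
  move=> Hx; have [Xx _] := Hx; rewrite -(subrKC x (face_proj P x)) -[_ - x]scale1r.
  apply: indep_face_segment => //.
  - by move=> i; exact: face_proj_ge0 Xx.
  - by apply: weight_face_proj; exact: heavy0.
  by move=> i xi; rewrite mxE xi mul0r if_same.
have va_out i : ~~ P i -> va ord0 i = 0.
  move=> Pi; rewrite mxE eqxx /=; case: eqP => // ia.
  by rewrite ia Pa in Pi.
have Xva : X va.
  apply/indep_realizationP; split => // i j /Pind.
  by rewrite negb_and => /orP[]/va_out ->; rewrite ?mul0r ?mulr0.
have id_cob : coboundary (heavy P) (fun x y => u x y (+) u (face_proj P x) (face_proj P y)).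
  apply: (@straight_line_coboundary R _ _ (heavy P) X d u id (face_proj P) 2 d0 cu).
  - by move=> eps eps0; exists eps.
  - exact: face_proj_unif_on.
  - move=> x Hx; rewrite (le_trans (ler_normB _ _)) // -[2]/(1 + 1) lerD //.
      by apply: (@indep_norm_le1 _ _ e); exact: Xproj.
    by apply: (@indep_norm_le1 _ _ e); case: Hx.
  move=> t x t01 Hx; apply: indep_face_segment => //; first by case: Hx.
  - by move=> i; apply: face_proj_ge0; case: Hx.
  - by apply: weight_face_proj; exact: heavy0.
  by move=> i xi; rewrite mxE xi mul0r if_same.
have proj_cob : coboundary (heavy P) (fun x y => u (face_proj P x) (face_proj P y) (+) u va va).
  apply: (@straight_line_coboundary R _ _ (heavy P) X d u (face_proj P) (fun=> va) 2 d0 cu).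
  - exact: face_proj_unif_on.
  - by move=> eps eps0; exists eps => // x y _ _ _; rewrite subrr normr0.
  - move=> x Hx; rewrite (le_trans (ler_normB _ _)) // -[2]/(1 + 1) lerD //.
      exact: indep_norm_le1 Xva.
    by apply: (@indep_norm_le1 _ _ e); exact: Xproj.
  move=> t x t01 Hx; apply: indep_segment => //.
  - by move=> i; apply: face_proj_ge0; case: Hx.
  - by apply: weight_face_proj; exact: heavy0.
  have out i : ~~ P i -> face_proj P x ord0 i + va ord0 i = 0.
    by move=> Pi; rewrite (va_out _ Pi) mxE (negbTE Pi) addr0.
  by move=> i j /Pind; rewrite negb_and => /orP[]/out ->; rewrite ?mul0r ?mulr0.
(* The two differences telescope to [u x y (+) u va va], and a cocycle vanishes on the diagonal. *)
apply: coboundary_eq (coboundaryD id_cob proj_cob) => x y _ _.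
by rewrite (cocycle_refl d0 cu Xva) addbF addbK.
Qed.
End Heavy.

(** * The overlap of the two halves, and gluing *)

Section Bipartite.
Variables (R : realType) (n : nat) (e : rel 'I_n) (c : 'I_n -> bool).
Hypotheses (esym : symmetric e) (bip : forall i j, e i j -> c i != c j).
Local Notation X := (indep_realization R e).
Local Notation overlap := (@heavy R _ e c `&` @heavy R _ e (predC c)).

Definition nonadjacent a b := [&& c a, ~~ c b & ~~ e a b].

(** For nonadjacent [a], [b] of distinct colours, these points serve as representatives of the
    components of the overlap. *)
Definition midpoint (a b : 'I_n) : 'rV[R]_n :=
  2^-1 *: (delta_mx ord0 a + delta_mx ord0 b).

Lemma midpointE a b i : midpoint a b ord0 i = 2^-1 * ((i == a)%:R + (i == b)%:R).
Proof. by rewrite !mxE. Qed.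

Lemma midpoint_ge0 a b i : 0 <= midpoint a b ord0 i.
Proof. by rewrite midpointE mulr_ge0 // addr_ge0. Qed.

Lemma weight_midpoint P a b : weight P (midpoint a b) = 2^-1 * ((P a)%:R + (P b)%:R).
Proof. by rewrite weightZ weightD !weight_delta. Qed.

Lemma weightT_midpoint a b : weight xpredT (midpoint a b) = 1.
Proof. by rewrite weight_midpoint /=; lra. Qed.

Lemma nonadjacent_weight a b : nonadjacent a b ->
  weight c (midpoint a b) = 2^-1 /\ weight (predC c) (midpoint a b) = 2^-1.
Proof. by move=> /and3P[ca /negbTE cb _]; rewrite !weight_midpoint /= ca cb /=; split; lra. Qed.

(** With the colouring, the four nonadjacencies make [a], [a'], [b], [b'] span a simplex; each
    colour keeps weight 1/2 along the segment. *)
Lemma midpoint_segment a b a' b' (t : R) :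
  nonadjacent a b -> nonadjacent a b' -> nonadjacent a' b -> nonadjacent a' b' ->
  0 <= t <= 1 ->
  overlap (midpoint a b + t *: (midpoint a' b' - midpoint a b)).
Proof.
move=> ab ab' a'b a'b' t01.
suff Xt : X (midpoint a b + t *: (midpoint a' b' - midpoint a b)).
  have [w1 w2] := nonadjacent_weight ab; have [w3 w4] := nonadjacent_weight a'b'.
  by split; split=> //; rewrite weight_segment ?w1 ?w2 ?w3 ?w4; lra.
apply: indep_segment => //; try exact: midpoint_ge0; try exact: weightT_midpoint.
have supp i : midpoint a b ord0 i + midpoint a' b' ord0 i != 0 ->
    if c i then i \in [:: a; a'] else i \in [:: b; b'].
  have /and3P[ca cb _] := ab; have /and3P[ca' cb' _] := a'b'.
  rewrite !midpointE !inE.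
  case: (eqVneq i a) => [->|_]; first by rewrite ca.
  case: (eqVneq i b) => [->|_]; first by rewrite (negbTE cb).
  case: (eqVneq i a') => [->|_]; first by rewrite ca' orbT.
  case: (eqVneq i b') => [->|_]; first by rewrite (negbTE cb') orbT.
  by rewrite !addr0 mulr0 addr0 eqxx.
have cross i j : c i -> ~~ c j -> e i j ->
    midpoint a b ord0 i + midpoint a' b' ord0 i != 0 ->
    midpoint a b ord0 j + midpoint a' b' ord0 j != 0 -> False.
  move=> ci /negbTE cj eij /supp + /supp; rewrite ci cj.
  by rewrite !inE => /orP[]/eqP ii /orP[]/eqP jj; move: eij; rewrite ii jj => eij;
   [case/and3P: ab|case/and3P: ab'|case/and3P: a'b|case/and3P: a'b'] => _ _ /negP; apply.
move=> i j eij; apply/eqP; rewrite mulf_eq0.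
apply/negP => /negP; rewrite negb_or => /andP[xi xj].
have := bip eij; case ci : (c i); case cj : (c j) => // _.
  by apply: (cross i j) => //; rewrite cj.
by apply: (cross j i) => //; rewrite ?ci // esym.
Qed.

(** Take [a] and [b] in the support of [x], one of each colour: the midpoint lies in the face
    carrying [x], and both weights move from at least 1/3 to 1/2. *)
Lemma overlap_segment x : overlap x -> exists a b, nonadjacent a b /\
  forall t : R, 0 <= t <= 1 -> overlap (x + t *: (midpoint a b - x)).
Proof.
move=> [[Xx xc] [_ xc']].
have [a ca xa] : exists2 a, c a & x ord0 a != 0.
  by apply: weight_neq0; rewrite gt_eqF //; lra.
have [b cb xb] : exists2 b, predC c b & x ord0 b != 0.
  by apply: weight_neq0; rewrite gt_eqF //; lra.
have [x0 x1 ind] := (indep_realizationP e x).1 Xx.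
have ab : nonadjacent a b.
  apply/and3P; split => //; apply/negP => /ind/eqP.
  by rewrite mulf_eq0 (negbTE xa) (negbTE xb).
exists a, b; split => // t t01.
suff Xt : X (x + t *: (midpoint a b - x)).
  have [w1 w2] := nonadjacent_weight ab; have /andP[t0 t1] := t01.
  by split; split=> //; rewrite weight_segment ?w1 ?w2; nra.
apply: indep_face_segment => //; try exact: midpoint_ge0; try exact: weightT_midpoint.
move=> i xi; rewrite midpointE.
case: eqP => [ia|_]; first by rewrite -ia xi eqxx in xa.
case: eqP => [ib|_]; first by rewrite -ib xi eqxx in xb.
by rewrite addr0 mulr0.
Qed.

(* [v] and [v'] are the primitives on the two halves; on the overlap their
   difference is a locally constant function. *)
Lemma coboundary_glue u d v v' t : 0 < d ->
  (forall x y, @heavy R _ e c x -> @heavy R _ e c y -> `|x - y| < d -> u x y = v x (+) v y) ->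
  (forall x y, @heavy R _ e (predC c) x -> @heavy R _ e (predC c) y -> `|x - y| < d ->
     u x y = v' x (+) v' y) ->
  (forall x, overlap x -> v x (+) v' x = t) ->
  coboundary X u.
Proof.
move=> d0 vP v'P vv'.
(* The second bound changes the weight by at most 1/6, so a point close to one of weight below 1/3
   has weight below 2/3 and lies in the second half. *)
pose d' := Num.min d (6 * (n%:R + 1))^-1.
have n0 : 0 < n%:R + 1 :> R by rewrite ltr_wpDl.
have d'0 : 0 < d' by rewrite lt_min d0 invr_gt0 mulr_gt0.
exists d' => //.
exists (fun x => if 3^-1 <= weight c x then v x else v' x (+) t).
move=> x y Xx Xy; rewrite lt_min => /andP[xy xy'].
have cxy : `|weight c x - weight c y| <= 6^-1.
  rewrite -weightB (le_trans (weight_norm _ _)) //.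
  apply: le_trans (_ : (n%:R + 1) * (6 * (n%:R + 1))^-1 <= _).
    by apply: ler_pM => //; [rewrite lerDl | exact: ltW].
  by rewrite invfM mulrCA divff ?mulr1 // gt_eqF.
move: cxy; rewrite ler_norml => /andP[cxy1 cxy2].
have wC z : X z -> weight (predC c) z = 1 - weight c z.
  by move=> /indep_realizationP[_ <- _]; rewrite (weightC c) addrC addKr.
have half z : X z -> weight c z <= 2 / 3 -> @heavy R _ e (predC c) z.
  by move=> Xz z3; split => //; rewrite wC //; lra.
have vE z : X z -> weight c z <= 2 / 3 ->
   (if 3^-1 <= weight c z then v z else v' z (+) t) = v' z (+) t.
  move=> Xz z3; case: ifP => // z3'; rewrite -(vv' z) ?addbA; last by split; [|exact: half].
  by case: (v z); case: (v' z).
have [x3|x3] := leP 3^-1 (weight c x); have [y3|y3] := leP 3^-1 (weight c y).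
- by rewrite vP.
- rewrite (_ : v x = v' x (+) t); last by have := vE x Xx; rewrite x3 => ->//; lra.
  by rewrite addbACA addbb addbF v'P //; apply: half => //; lra.
- rewrite (_ : v y = v' y (+) t); last by have := vE y Xy; rewrite y3 => ->//; lra.
  by rewrite addbACA addbb addbF v'P //; apply: half => //; lra.
- by rewrite addbACA addbb addbF v'P //; apply: half => //; lra.
Qed.

End Bipartite.

(** * The dichotomy and the theorem *)

(** The jump between the primitives on the two halves is a vector of three bits, constant on each
    component of the overlap. If the jumps lie in an affine plane, its normal gives a combination
    with constant jump, which glues; otherwise four components have distinct jumps. *)
Lemma coboundary_or_cube (R : realType) n (e : rel 'I_n) (c : 'I_n -> bool) d
    (u : nat -> 'rV[R]_n -> 'rV[R]_n -> bool) :
  symmetric e -> (forall i j, e i j -> c i != c j) -> 0 < d ->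
  (forall j, cocycle (indep_realization R e) d (u j)) ->
  (exists nn : nat -> bool, [|| nn 0%N, nn 1%N | nn 2%N] /\
     coboundary (indep_realization R e) (comb3 nn u)) \/
  (exists a b : 'I_4 -> 'I_n, [/\ forall i, c (a i), forall i, ~~ c (b i) &
     forall i j, e (a i) (b j) = (i != j)]).
Proof.
move=> esym bip d0 cu.
have prim j : exists p : R * (('rV[R]_n -> bool) * ('rV[R]_n -> bool)),
  [/\ 0 < p.1,
    forall x y, heavy e c x -> heavy e c y -> `|x - y| < p.1 -> u j x y = p.2.1 x (+) p.2.1 y &
    forall x y, heavy e (predC c) x -> heavy e (predC c) y -> `|x - y| < p.1 ->
      u j x y = p.2.2 x (+) p.2.2 y].
  have [|d1 d10 [v vP]] := @heavy_coboundary R n e c d (u j) d0 _ (cu j).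
    by move=> i k /bip; case: (c i); case: (c k).
  have [|d2 d20 [v' v'P]] := @heavy_coboundary R n e (predC c) d (u j) d0 _ (cu j).
    by move=> i k /bip /=; case: (c i); case: (c k).
  exists (Num.min d1 d2, (v, v')); split => /=; first by rewrite lt_min d10.
    by move=> x y hx hy; rewrite lt_min => /andP[? ?]; exact: vP.
  by move=> x y hx hy; rewrite lt_min => /andP[? ?]; exact: v'P.
have [p pP] := choice prim.
pose w j x := (p j).2.1 x (+) (p j).2.2 x.
pose overlap : set 'rV[R]_n := heavy e c `&` heavy e (predC c).
have wconst j x y : overlap x -> overlap y -> `|x - y| < (p j).1 -> w j x = w j y.
  move=> [x1 x2] [y1 y2] xy; have [_ /(_ _ _ x1 y1 xy) h1 /(_ _ _ x2 y2 xy) h2] := pP j.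
  move: h1; rewrite h2 /w.
  by case: ((p j).2.1 x); case: ((p j).2.1 y); case: ((p j).2.2 x); case: ((p j).2.2 y).
have p0 j : 0 < (p j).1 by case: (pP j).
pose D j (ab : 'I_n * 'I_n) := w j (midpoint R ab.1 ab.2).
pose E := [pred ab : 'I_n * 'I_n | nonadjacent e c ab.1 ab.2].
have Deq j a b a' b' : nonadjacent e c a b -> nonadjacent e c a b' ->
    nonadjacent e c a' b -> nonadjacent e c a' b' -> D j (a, b) = D j (a', b').
  move=> ab ab' a'b a'b'.
  by apply: (straight_line_const (p0 j) (wconst j)) => t t01; exact: midpoint_segment.
have [[nn [t [nn0 nnt]]]|[z [Ez Dz]]] := affine_or_four E D.
  left; exists nn; split => //.
  pose d' := Num.min (p 0%N).1 (Num.min (p 1%N).1 (p 2%N).1).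
  have d'0 : 0 < d' by rewrite !lt_min !p0.
  have close (x y : 'rV[R]_n) : `|x - y| < d' -> forall j, (j < 3)%N -> `|x - y| < (p j).1.
    by rewrite !lt_min => /and3P[? ? ?] [|[|[|]]].
  apply: (@coboundary_glue R n e c _ d' (fun x => dot3 nn (fun j => (p j).2.1 x))
    (fun x => dot3 nn (fun j => (p j).2.2 x)) t) => //.
  - move=> x y hx hy /close xy; rewrite -dot3D; apply: eq_dot3 => j j3.
    by have [_ -> //] := pP j; exact: xy.
  - move=> x y hx hy /close xy; rewrite -dot3D; apply: eq_dot3 => j j3.
    by have [_ _ -> //] := pP j; exact: xy.
  - move=> x Ox; have [a [b [ab abP]]] := overlap_segment Ox.
    rewrite -(nnt (a, b) ab) -dot3D; apply: eq_dot3 => j _.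
    exact: (straight_line_const (p0 j) (wconst j)).
right; exists (fun i => (z i).1), (fun i => (z i).2).
have N i : nonadjacent e c (z i).1 (z i).2 by exact: Ez.
split=> [i|i|i j]; try by case/and3P: (N i).
have [<-|ij] := eqVneq i j; first by case/and3P: (N i) => _ _ /negbTE.
(* If [a i] and [b j] were nonadjacent, the pair they form would link the pairs of index [i] and [j]
   in the overlap, forcing equal jumps. *)
apply/negPn/negP => nij.
have {}nij : nonadjacent e c (z i).1 (z j).2.
  by apply/and3P; split => //; [case/and3P: (N i)|case/and3P: (N j)].
have [k /negP[]] := Dz _ _ ij; apply/eqP.
rewrite [z i]surjective_pairing [z j]surjective_pairing.
by rewrite (Deq k _ _ (z i).1 (z j).2) //; apply: Deq.
Qed.

Theorem mainTheorem7 (R : realType) (n : nat) (e : rel 'I_n) (k : nat) :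
  symmetric e -> irreflexive e ->
  is_circle_graph e -> is_bipartite e -> (3 <= k)%N ->
  ~ homotopy_equivalent R (indep_realization R e) (wedge_circles R k).
Proof.
move=> esym eirr [p [q [dg pq]]] [c bip] k3 [f [g [[cf fXW cg gWX] [_ [H [cH HW H0 H1]]]]]].
set X := indep_realization R e in cf fXW gWX *.
set W := wedge_circles R k in fXW cg gWX cH HW H0 H1 *.
have fX x : X x -> W (f x) by move=> Xx; apply: fXW; exists x.
have gW x : W x -> X (g x) by move=> Wx; apply: gWX; exists x.
have cW : compact W by exact: wedge_circles_compact.
have uf : unif_on X f by apply: compact_unif_on cf; exact: indep_realization_compact.
have ug : unif_on W g by exact: compact_unif_on cg.
have d0 : 0 < 4^-1 :> R by [].
have [d1 d10 d1P] := uf _ d0.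
have cu j : cocycle X d1 (fun x y => ray_cut j (f x) (f y)).
  move=> x y z Xx Xy Xz xy yz xz.
  by apply: (@ray_cut_cocycle R k j); try exact: fX; exact: d1P.
have [[nn [nn0 cob]]|[a [b [ca cb eab]]]] := coboundary_or_cube esym bip d10 cu.
  (* A vanishing combination on [X] is pulled back along [g]; the homotopy from [f \o g] to the
     identity carries the vanishing over to the combination on [W] itself. *)
  have cobW : coboundary W (fun x y => comb3 nn (@ray_cut R) (f (g x)) (f (g y))).
    exact: coboundary_comp ug gW cob.
  have cobH : coboundary W (fun x y => comb3 nn (@ray_cut R) (H (0, x)) (H (0, y)) (+)
                                  comb3 nn (@ray_cut R) (H (1, x)) (H (1, y))).
    apply: (@homotopy_coboundary R _ _ W W 4^-1 (comb3 nn (@ray_cut R)) (fun t x => H (t, x)) d0).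
    - by apply: comb3_cocycle => j; exact: ray_cut_cocycle.
    - by move=> t x t01 Wx; exact: HW.
    have cI : compact (unit_interval R `*` W).
      apply: compact_setX => //.
      have -> : unit_interval R = [set` `[0, 1]].
        by apply/seteqP; split => t; rewrite /= in_itv.
      exact: segment_compact.
    have [e' e'0 e'P] := @compact_unif_on R (R^o * 'rV[R]_2)%type _ _ H cI cH _ d0.
    exists e' => // s t x y s01 t01 Wx Wy st xy; apply: e'P => //.
    by rewrite prod_normE /= gt_max st.
  have : coboundary W (comb3 nn (@ray_cut R)).
    apply: coboundary_eq (coboundaryD cobW cobH) => x y Wx Wy /=.
    by rewrite !H0 // !H1 //= addKb.
  by move=> /(ray_cut_independent k3)[n0 n1 n2]; move: nn0; rewrite n0 n1 n2.
have ab i j : a i != b j by apply/eqP => abij; move: (cb j); rewrite -abij ca.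
have aa i j : i != j -> a i != a j.
  move=> ij; apply/eqP => aij; have := eab i i; rewrite aij eab eqxx.
  by rewrite eq_sym ij.
(* Chords [a i] have one colour, so they do not cross each other; they cross [b j] exactly when
   [i != j]. *)
apply: (no_cube_minus_vertex dg aa ab) => [i j ij|i j|i].
- by rewrite -pq ?aa //; apply/negP => /bip; rewrite !ca.
- by rewrite -pq; [rewrite esym eab | rewrite eq_sym ab].
- by rewrite -pq ?ab // eab eqxx.
Qed.
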